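(* Let $G=(U,V,E)$ be a complete bipartite graph with edge labels in $\{\pm1\}$, $m=|U|$, $n=|V|$, bi-adjacency matrix $\mathbf{B}\in\{\pm1\}^{m\times n}$, let $k\ge1$ be an integer and $\delta\in(0,1)$. Run the following procedure: set $\epsilon=2^{-3}\delta k^{-1/2}$ and $r=2^{6}\delta^{-2}-1$; compute the rank-$r$ truncated SVD $\widetilde{\mathbf{B}}$ of $\mathbf{B}$; run BiLinearLowRankSolver on input $\widetilde{\mathbf{B}}$ with accuracy $\epsilon$, over $\mathcal{X}=\{\mathbf{X}\in\{0,1\}^{m\times k}:\|\mathbf{X}\|_{\infty,1}=1\}$ and $\mathcal{Y}=\{\mathbf{Y}\in\{0,1\}^{n\times k}:\|\mathbf{Y}\|_{\infty,1}=1\}$, using as both oracles the row-wise argmax rule (given $\mathbf{L}$, put a single $1$ in each row $i$ at a column $j_i\in\arg\max_j L_{ij}$). The output pair $(\widetilde{\mathbf{X}},\widetilde{\mathbf{Y}})$ defines a clustering $\widetilde{\mathcal{C}}^{(k)}$ of $U\cup V$ into at most $k$ clusters (vertex $i\in U$ goes to cluster $j$ iff $\widetilde X_{ij}=1$, similarly for $V$ via $\widetilde{\mathbf{Y}}$). Then $$\mathrm{Agree}(\widetilde{\mathcal{C}}^{(k)})\ge(1-\delta)\,\mathrm{Agree}(\mathcal{C}^{(k)}_\star),$$ where $\mathcal{C}^{(k)}_\star$ is a clustering of $U\cup V$ into at most $k$ clusters maximizing the number of agreements, and the running time is $2^{O(\frac{k}{\delta^{2}}\log\frac{\sqrt k}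{\delta})}\cdot(\delta^{-2}+k)\cdot(|U|+|V|)+\mathrm{T}_{\mathrm{SVD}}(\delta^{-2})$.
   Context: For a clustering $\mathcal{C}$ of $U\cup V$, $\mathrm{Agree}(\mathcal{C})$ is the number of $+1$ edges with both endpoints in the same cluster plus the number of $-1$ edges with endpoints in different clusters. $\|\mathbf{X}\|_{\infty,1}$ is the maximum row $\ell_1$-norm. BiLinearLowRankSolver (input $\widetilde{\mathbf{A}}$ of rank $r$, accuracy $\epsilon$, oracles $\mathrm{P}_{\mathcal{X}},\mathrm{P}_{\mathcal{Y}}$ returning maximizers of $\operatorname{Tr}(\mathbf{X}^\top\mathbf{L})$ over $\mathcal{X}$ and of $\operatorname{Tr}(\mathbf{R}^\top\mathbf{Y})$ over $\mathcal{Y}$): compute the truncated SVD $\widetilde{\mathbf{A}}=\widetilde{\mathbf{U}}\widetilde{\mathbf{\Sigma}}\widetilde{\mathbf{V}}^\top$, $\widetilde{\mathbf{\Sigma}}\in\mathbb{R}^{r\times r}$; fix an $\epsilon$-net in $\ell_2$ of the unit $\ell_2$-ball of $\mathbb{R}^r$ of cardinality at most $(2\sqrt r/\epsilon)^r$; for each $r\times k$ matrix $\mathbf{C}$ with all columns in the net, set $\mathbf{L}=\widetilde{\mathbf{U}}\widetilde{\mathbf{\Sigma}}\mathbf{C}$, $\mathbf{X}=\mathrm{P}_{\mathcal{X}}(\mathbf{L})$, $\mathbf{R}=\mathbf{X}^\top\widetilde{\mathbf{A}}$ (transposed as needed), $\mathbf{Y}=\mathrm{P}_{\mathcal{Y}}(\mathbf{R})$,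 record $(\mathbf{X},\mathbf{Y})$; output the recorded pair maximizing $\operatorname{Tr}(\mathbf{X}^\top\widetilde{\mathbf{A}}\mathbf{Y})$. $\mathrm{T}_{\mathrm{SVD}}(s)$ denotes the time to compute a rank-$s$ truncated SVD of $\mathbf{B}$.
   Formalization: The rank r is rounded up to an integer; the SVD term is the time for the rank r actually computed, T_SVD(r), instead of T_SVD(δ^{-2}); and the factor 2^{O(·)} carries an additional absolute constant factor, needed when k=1 and δ tends to 1. *)

(* Defs.v *)
From mathcomp Require Import all_boot all_order all_algebra.
From mathcomp Require Import reals exp.

Set Implicit Arguments.
Unset Strict Implicit.
Unset Printing Implicit Defensive.

Import Order.TTheory GRing.Theory Num.Theory.
Local Open Scope ring_scope.

(** * Nondeterministic programs with a running time

    [p a t] reads "some execution of [p] returns [a] after [t] steps".  The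
    machine is a real RAM: a scalar addition, multiplication, comparison or
    copy is one step.  Nondeterminism stands for the choices the procedure
    leaves open (which SVD, which net, how ties in an argmax are broken). *)

Definition prog (A : Type) := A -> nat -> Prop.

Definition charge (A : Type) (c : nat) (a : A) : prog A :=
  fun b t => b = a /\ t = c.

Definition ret (A : Type) (a : A) : prog A := charge 0 a.

Definition choose_any (A : Type) (P : A -> Prop) (cost : A -> nat) : prog A :=
  fun a t => P a /\ t = cost a.

Definition bind (A A' : Type) (p : prog A) (f : A -> prog A') : prog A' :=
  fun b t => exists a t1 t2, [/\ p a t1, f a b t2 & t = (t1 + t2)%N].

Notation "'let!' x ':=' p 'in' q" := (bind p (fun x => q))
  (at level 200, x name, p at level 100, q at level 200).

(** Independent iterations, one for each [i : I], executed in sequence. *)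
Definition loop (I : finType) (A : Type) (F : I -> prog A) : prog (I -> A) :=
  fun g t => exists c : I -> nat,
    (forall i, F i (g i) (c i)) /\ t = (\sum_i c i)%N.

(** One comparison; on a tie either argument may be returned. *)
Definition better (R : realType) (T : Type) (v : T -> R) (x y : T) : prog T :=
  fun z t => ((z = x /\ v y <= v x) \/ (z = y /\ v x <= v y)) /\ t = 1%N.

Fixpoint argmaxP (R : realType) (T : Type) (v : T -> R) (s : seq T) : prog T :=
  match s with
  | [::] => fun _ _ => False
  | [:: x] => ret x
  | x :: s' => let! y := argmaxP v s' in better v x y
  end.

Fixpoint dotP (R : realType) (I : Type) (s : seq I) (x y : I -> R) : prog R :=
  if s is i :: s' then
    let! a := dotP s' x y in
    let! b := charge 1 (x i * y i) in
    charge 1 (a + b)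
  else ret 0.

Definition mxloop (R : realType) (p q : nat) (F : 'I_p -> 'I_q -> prog R) :
    prog 'M[R]_(p, q) :=
  let! g := loop (fun ij : 'I_p * 'I_q => F ij.1 ij.2) in
  ret (\matrix_(i, j) g (i, j)).

Definition matmulP (R : realType) (p q l : nat)
    (M : 'M[R]_(p, q)) (N : 'M[R]_(q, l)) : prog 'M[R]_(p, l) :=
  mxloop (fun i j => dotP (enum 'I_q) (fun a => M i a) (fun a => N a j)).

(** [\tr (M^T *m N)] *)
Definition trdotP (R : realType) (p q : nat) (M N : 'M[R]_(p, q)) : prog R :=
  dotP (enum {: 'I_p * 'I_q}) (fun ij => M ij.1 ij.2) (fun ij => N ij.1 ij.2).

(** * Singular value decompositions *)

Definition is_svd (R : realType) (m n p : nat) (A : 'M[R]_(m, n))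
    (U : 'M[R]_(m, p)) (sigma : 'rV[R]_p) (V : 'M[R]_(n, p)) : Prop :=
  [/\ U^T *m U = 1%:M, V^T *m V = 1%:M,
      forall i, 0 <= sigma 0 i,
      forall i j : 'I_p, (i <= j)%N -> sigma 0 j <= sigma 0 i
    & A = U *m diag_mx sigma *m V^T].

Record factors (R : realType) (m n : nat) := Factors {
  fdim : nat;
  fleft : 'M[R]_(m, fdim);
  fvals : 'rV[R]_fdim;
  fright : 'M[R]_(n, fdim) }.

Definition mx_of_factors (R : realType) (m n : nat) (F : factors R m n) :
    'M[R]_(m, n) :=
  fleft F *m diag_mx (fvals F) *m (fright F)^T.

(** [F] is the leading part of an SVD of [A] having [p] singular values in
    total.  It keeps [r] of them, or all [p] when [p < r]; since the columns
    are orthonormal, [p <= minn m n], so no more can be kept. *)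
Definition truncated_svd (R : realType) (m n : nat) (A : 'M[R]_(m, n))
    (r : nat) (F : factors R m n) : Prop :=
  exists q (U' : 'M[R]_(m, q)) (sigma' : 'rV[R]_q) (V' : 'M[R]_(n, q)),
    is_svd A (row_mx (fleft F) U') (row_mx (fvals F) sigma')
             (row_mx (fright F) V')
    /\ fdim F = minn r (fdim F + q).

(** * The solver *)

Definition norm2 (R : realType) (s : nat) (x : 'cV[R]_s) : R :=
  Num.sqrt (\sum_i x i 0 ^+ 2).

(** The net need not be contained in the ball, so internal and external nets
    are both covered. *)
Definition eps_net (R : realType) (s : nat) (eps : R) (N : seq 'cV[R]_s) :
    Prop :=
  (forall x, norm2 x <= 1 -> exists2 c, c \in N & norm2 (x - c) <= eps)
  /\ (size N)%:R <= (2 * Num.sqrt s%:R / eps) ^+ s.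

Section Solver.
Variables (R : realType) (m n k : nat).

(** The low-rank input matrix [mx_of_factors F] is held as its SVD [F] and is
    never expanded (that alone would take [m * n] steps); hence its SVD costs
    nothing beyond the computation of [F].  The loop runs over
    the [s * k] matrices [C] whose columns are the net points selected by [f].
    The recorded value is [\tr (RR^T *m Y)] with
    [RR = (mx_of_factors F)^T *m X]. *)
Definition bilinear_low_rank_solver (F : factors R m n) (eps : R)
    (PX : 'M[R]_(m, k) -> prog 'M[R]_(m, k))
    (PY : 'M[R]_(n, k) -> prog 'M[R]_(n, k)) :
    prog ('M[R]_(m, k) * 'M[R]_(n, k)) :=
  let s := fdim F in
  let! N := choose_any (eps_net eps) (fun N : seq 'cV[R]_s => s * size N)%N in
  let! US := matmulP (fleft F) (diag_mx (fvals F)) in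
  let! rec := loop (fun f : {ffun 'I_k -> 'I_(size N)} =>
    let! C := mxloop (fun i j => charge 1 ((nth 0 N (f j)) i 0)) in
    let! L := matmulP US C in
    let! X := PX L in
    let! W := matmulP US^T X in
    let! RR := matmulP (fright F) W in
    let! Y := PY RR in
    let! v := trdotP RR Y in
    ret (v, (X, Y))) in
  let! best := argmaxP (fun f => (rec f).1)
                       (enum {: {ffun 'I_k -> 'I_(size N)}}) in
  ret (rec best).2.

(** [norm_inf1 X] is the maximum row [l1]-norm. *)
Definition norm_inf1 (p : nat) (X : 'M[R]_(p, k)) : R :=
  \big[Num.max/0]_(i < p) \sum_(j < k) `|X i j|.

Definition feasible (p : nat) (X : 'M[R]_(p, k)) : Prop :=
  (forall i j, X i j = 0 \/ X i j = 1) /\ norm_inf1 X = 1.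

Definition row_argmax (p : nat) (L : 'M[R]_(p, k)) : prog 'M[R]_(p, k) :=
  let! j_ := loop (fun i : 'I_p => argmaxP (fun j => L i j) (enum 'I_k)) in
  mxloop (fun i j => charge 1 (j == j_ i)%:R).

(** * The clustering procedure *)

(** The integer [r] with [r + 1 >= 2^6 / delta^2], rounded up when
    [2^6 / delta^2] is not an integer. *)
Definition svd_rank (delta : R) : nat :=
  `|Num.ceil (2 ^+ 6 * delta ^- 2 - 1)|%N.

(** [TSVD s] is the time taken to compute a rank-[s] truncated SVD of [B]. *)
Definition bcc_procedure (B : 'M[R]_(m, n)) (delta : R) (TSVD : nat -> nat) :
    prog ('M[R]_(m, k) * 'M[R]_(n, k)) :=
  let eps := 2 ^- 3 * delta / Num.sqrt k%:R in
  let r := svd_rank delta in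
  let! F := choose_any (truncated_svd B r) (fun _ => TSVD r) in
  bilinear_low_rank_solver F eps (@row_argmax m) (@row_argmax n).

(** * Bipartite correlation clustering

    The vertex set is the disjoint union ['I_m + 'I_n]; [B i j] is the label of
    the edge between [inl i] and [inr j]. *)

Notation vertex := ('I_m + 'I_n)%type.

Definition same_cluster (P : {set {set vertex}}) (x y : vertex) : bool :=
  [exists A in P, (x \in A) && (y \in A)].

Definition agree (B : 'M[R]_(m, n)) (P : {set {set vertex}}) : nat :=
  addn
    #|[set e : 'I_m * 'I_n |
       (B e.1 e.2 == 1) && same_cluster P (inl e.1) (inr e.2)]|
    #|[set e : 'I_m * 'I_n |
       (B e.1 e.2 == -1) && ~~ same_cluster P (inl e.1) (inr e.2)]|.

Definition clustering_at_most (P : {set {set vertex}}) : Prop :=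
  partition P [set: vertex] /\ (#|P| <= k)%N.

Definition optimal_clustering (B : 'M[R]_(m, n)) (P : {set {set vertex}}) :
    Prop :=
  clustering_at_most P /\
  forall Q, clustering_at_most Q -> (agree B Q <= agree B P)%N.

Definition cluster (X : 'M[R]_(m, k)) (Y : 'M[R]_(n, k)) (j : 'I_k) :
    {set vertex} :=
  [set x : vertex | match x with
                    | inl i => X i j == 1
                    | inr i => Y i j == 1
                    end].

Definition clustering_of (X : 'M[R]_(m, k)) (Y : 'M[R]_(n, k)) :
    {set {set vertex}} :=
  [set cluster X Y j | j : 'I_k] :\ set0.

End Solver.

(* Main.v *)
(** For 0/1 assignment matrices [X], [Y], the number of agreements is the number
    of negative edges plus [<X, B Y>].  Replacing [B] by its rank-[r] truncation
    changes this bilinear form by at most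
    [sigma_(r+1) sqrt m sqrt n <= m n / sqrt (r+1) <= delta m n / 8], since
    [(r+1) sigma_(r+1)^2 <= ||B||_F^2 = m n].  For the truncation [U S V^T], some
    net matrix [C] approximates [V^T Y* / sqrt n] column by column within [eps];
    answering [C] with the row-wise argmax twice loses at most
    [2 eps sqrt k sigma_1 sqrt m sqrt n <= delta m n / 4] against [<X*, U S V^T Y*>].
    The total loss [delta m n / 2] is at most [delta] times the optimum, which is
    at least [m n / 2] when [k >= 2]; for [k = 1] only one clustering exists. *)

Require Import Defs.
From mathcomp Require Import all_boot all_order all_algebra.
From mathcomp Require Import reals sequences exp ring lra zify.

Set Implicit Arguments.
Unset Strict Implicit.
Unset Printing Implicit Defensive.

Import Order.TTheory GRing.Theory Num.Theory.
Local Open Scope ring_scope.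

Section Programs.
Context {R : realType}.

Lemma dotPE (I : Type) (s : seq I) (x y : I -> R) a t :
  dotP s x y a t -> a = \sum_(i <- s) x i * y i /\ t = (2 * size s)%N.
Proof.
elim: s a t => [|i s IH] a t /=; first by case=> -> ->; rewrite big_nil.
move=> [a' [t1 [t2 [/IH[-> ->] [b [t3 [t4 [[-> ->] [-> ->] ->]]]] ->]]]].
by rewrite big_cons [RHS]addrC mulnSr addn1 addn2.
Qed.

Lemma mxloopE (p q : nat) (F : 'I_p -> 'I_q -> prog R) (A : 'M[R]_(p, q)) t :
  mxloop F A t -> exists c : 'I_p * 'I_q -> nat,
    (forall i j, F i j (A i j) (c (i, j))) /\ t = (\sum_ij c ij)%N.
Proof.
move=> [g [t1 [t2 [[c [Fg ->]] [-> ->] ->]]]]; exists c; rewrite addn0.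
by split=> // i j; rewrite mxE; exact: (Fg (i, j)).
Qed.

Lemma mxloop_charge (p q : nat) (E : 'I_p -> 'I_q -> R) (A : 'M[R]_(p, q)) t :
  mxloop (fun i j => charge 1 (E i j)) A t ->
  A = \matrix_(i, j) E i j /\ t = (p * q)%N.
Proof.
move=> /mxloopE[c [FA ->]]; split.
  by apply/matrixP => i j; rewrite mxE; case: (FA i j).
rewrite (eq_bigr (fun=> 1%N)); last by move=> [i j] _; case: (FA i j).
by rewrite sum_nat_const card_prod !card_ord muln1.
Qed.

Lemma matmulPE (p q l : nat) (M : 'M[R]_(p, q)) (N : 'M[R]_(q, l)) A t :
  matmulP M N A t -> A = M *m N /\ t = (p * l * (2 * q))%N.
Proof.
move=> /mxloopE[c [FA ->]]; split.
  apply/matrixP => i j; rewrite mxE; have [-> _] := dotPE (FA i j).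
  by rewrite big_enum.
rewrite (eq_bigr (fun=> 2 * q)%N); last first.
  by move=> [i j] _; have [_ ->] := dotPE (FA i j); rewrite size_enum_ord.
by rewrite sum_nat_const card_prod !card_ord.
Qed.

Lemma trdotPE (p q : nat) (M N : 'M[R]_(p, q)) v t :
  trdotP M N v t -> v = \tr (M^T *m N) /\ t = (2 * (p * q))%N.
Proof.
move=> /dotPE[-> ->]; rewrite -cardT card_prod !card_ord; split=> //.
rewrite big_enum /= /mxtrace.
under [RHS]eq_bigr do rewrite mxE.
rewrite exchange_big pair_big /=.
by apply: eq_bigr => ij _; rewrite mxE.
Qed.

Lemma argmaxPE (T : eqType) (v : T -> R) (s : seq T) z t :
  argmaxP v s z t ->
  [/\ z \in s, forall y, y \in s -> v y <= v z & (t < size s)%N].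
Proof.
elim: s z t => [//|x [|x' s] IH] z t.
  case=> -> ->; split=> //; first exact: mem_head.
  by move=> y; rewrite inE => /eqP ->.
move=> [y [t1 [t2 [/IH[ys ymax t1s] [vz ->] ->]]]]; split.
- by case: vz => [[-> _]|[-> _]]; rewrite inE ?eqxx // ys orbT.
- move=> w; rewrite inE => /predU1P[->|/ymax wy].
    by case: vz => [[-> _]|[->]].
  by case: vz => [[-> yx]|[-> _]] //; exact: le_trans yx.
- by rewrite addn1.
Qed.

End Programs.

Definition assign_mx {R : realType} {p k : nat} (a : 'I_p -> 'I_k) :
    'M[R]_(p, k) := \matrix_(i, j) (j == a i)%:R.

Section Assignments.
Context {R : realType} {k : nat}.

Lemma row_argmaxE (p : nat) (L : 'M[R]_(p, k)) X t : row_argmax L X t ->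
  exists a : 'I_p -> 'I_k, [/\ X = assign_mx a,
    forall i j, L i j <= L i (a i) & (t <= 2 * (p * k))%N].
Proof.
move=> [a [t1 [t2 [[c [cP ->]] /mxloop_charge[-> ->] ->]]]]; exists a; split=> //.
  by move=> i j; have [_ + _] := argmaxPE (cP i); apply; rewrite mem_enum.
rewrite mul2n -addnn leq_add2r -[p in leqRHS]card_ord -sum_nat_const.
apply: leq_sum => i _; have [_ _ /ltnW] := argmaxPE (cP i).
by rewrite size_enum_ord.
Qed.

Lemma trace_assign_mx (p : nat) (a : 'I_p -> 'I_k) (L : 'M[R]_(p, k)) :
  \tr ((assign_mx a)^T *m L) = \sum_i L i (a i).
Proof.
rewrite /mxtrace; under eq_bigr do rewrite mxE.
rewrite exchange_big /=.
apply: eq_bigr => i _; rewrite (bigD1 (a i)) //= big1 ?addr0 => [|j ja].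
  by rewrite !mxE eqxx mul1r.
by rewrite !mxE (negbTE ja) mul0r.
Qed.

Lemma trace_argmax (p : nat) (L : 'M[R]_(p, k)) (a b : 'I_p -> 'I_k) :
  (forall i j, L i j <= L i (a i)) ->
  \tr ((assign_mx b)^T *m L) <= \tr ((assign_mx a)^T *m L).
Proof. by move=> La; rewrite !trace_assign_mx; apply: ler_sum. Qed.

Lemma assign_mx_feasible (p : nat) (a : 'I_p -> 'I_k) : (0 < p)%N ->
  feasible (assign_mx a : 'M[R]_(p, k)).
Proof.
move=> p0; split=> [i j|]; first by rewrite mxE; case: eqP => _; [right|left].
have rowE i : \sum_(j < k) `|assign_mx a i j : R| = 1.
  rewrite (bigD1 (a i)) //= big1 ?addr0 => [|j /negbTE ja].
    by rewrite mxE eqxx normr1.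
  by rewrite mxE ja normr0.
rewrite /norm_inf1 (eq_bigr _ (fun i _ => rowE i)).
apply/eqP; rewrite eq_le; apply/andP; split; first exact: bigmax_le.
exact: (le_bigmax _ (fun=> 1) (Ordinal p0)).
Qed.

Context {m n : nat}.
Notation vertex := ('I_m + 'I_n)%type.
Variables (a : 'I_m -> 'I_k) (b : 'I_n -> 'I_k).
Let X : 'M[R]_(m, k) := assign_mx a.
Let Y : 'M[R]_(n, k) := assign_mx b.

Lemma trace_bilinear (M : 'M[R]_(m, n)) :
  \tr (X^T *m M *m Y) = \sum_i \sum_j M i j * (a i == b j)%:R.
Proof.
rewrite -mulmxA trace_assign_mx; apply: eq_bigr => i _.
by rewrite mxE; apply: eq_bigr => j _; rewrite mxE.
Qed.

Let label (x : vertex) : 'I_k := match x with inl i => a i | inr j => b j end.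

Lemma mem_cluster x c : (x \in cluster X Y c) = (c == label x).
Proof.
by rewrite inE; case: x => i; rewrite mxE pnatr_eq1 eqb1.
Qed.

Lemma cluster_in x : cluster X Y (label x) \in clustering_of X Y.
Proof.
rewrite in_setD1 imset_f // andbT; apply/set0Pn; exists x.
by rewrite mem_cluster.
Qed.

Lemma same_cluster_assign x y :
  same_cluster (clustering_of X Y) x y = (label x == label y).
Proof.
apply/'exists_andP/eqP => [[A [+ /andP[]]]|xy].
  rewrite in_setD1 => /andP[_ /imsetP[c _ ->]].
  by rewrite !mem_cluster => /eqP <- /eqP.
by exists (cluster X Y (label x)); rewrite cluster_in !mem_cluster xy !eqxx.
Qed.

Lemma clustering_of_assign : clustering_at_most k (clustering_of X Y).
Proof.
split; last first.
  rewrite (leq_trans (subset_leq_card (subsetDl _ _))) //.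
  by rewrite (leq_trans (leq_imset_card _ _)) // cardE size_enum_ord.
apply/and3P; split; last by rewrite !inE eqxx.
  apply/eqP/setP => x; rewrite inE; apply/bigcupP.
  by exists (cluster X Y (label x)); rewrite ?cluster_in // mem_cluster.
apply/trivIsetP => A B; rewrite !in_setD1.
move=> /andP[_ /imsetP[c _ ->]] /andP[_ /imsetP[d _ ->]] cd.
rewrite -setI_eq0; apply/eqP/setP => x; rewrite in_setI !mem_cluster inE.
by apply/negP => /andP[/eqP ec /eqP ed]; rewrite ec ed eqxx in cd.
Qed.

End Assignments.

Definition dotmx {R : realType} {p q : nat} (A B : 'M[R]_(p, q)) : R := \tr (A^T *m B).

Section Frobenius.
Context {R : realType}.

Lemma dotmxE (p q : nat) (A B : 'M[R]_(p, q)) :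
  dotmx A B = \sum_j \sum_i A i j * B i j.
Proof.
apply: eq_bigr => j _; rewrite mxE.
by apply: eq_bigr => i _; rewrite mxE.
Qed.

Lemma dotmxC (p q : nat) (A B : 'M[R]_(p, q)) : dotmx A B = dotmx B A.
Proof. by rewrite /dotmx -mxtrace_tr trmx_mul trmxK. Qed.

Lemma dotmx_ge0 (p q : nat) (A : 'M[R]_(p, q)) : 0 <= dotmx A A.
Proof.
by rewrite dotmxE; apply: sumr_ge0 => j _; apply: sumr_ge0 => i _; rewrite -expr2 sqr_ge0.
Qed.

Lemma dotmxDr (p q : nat) (A B C : 'M[R]_(p, q)) :
  dotmx A (B + C) = dotmx A B + dotmx A C.
Proof. by rewrite /dotmx mulmxDr mxtraceD. Qed.

Lemma dotmxZr (p q : nat) c (A B : 'M[R]_(p, q)) :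
  dotmx A (c *: B) = c * dotmx A B.
Proof. by rewrite /dotmx -scalemxAr mxtraceZ. Qed.

Lemma dotmx_mull (p q l : nat) (U : 'M[R]_(p, q)) (A : 'M[R]_(p, l)) B :
  dotmx A (U *m B) = dotmx (U^T *m A) B.
Proof. by rewrite /dotmx trmx_mul trmxK mulmxA. Qed.

Lemma Cauchy_Schwarz_dotmx (p q : nat) (A B : 'M[R]_(p, q)) :
  dotmx A B ^+ 2 <= dotmx A A * dotmx B B.
Proof.
have sqrD c : 0 <= dotmx A A * c ^+ 2 + c * dotmx A B *+ 2 + dotmx B B.
  have := dotmx_ge0 (c *: A + B).
  rewrite dotmxDr dotmxZr ![dotmx (_ + _) _]dotmxC !dotmxDr !dotmxZr.
  by rewrite (dotmxC B A); congr (_ <= _); ring.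
have := dotmx_ge0 A; rewrite le_eqVlt => /predU1P[A0|A0].
  have [->|AB0] := eqVneq (dotmx A B) 0; first by rewrite expr0n -A0 mul0r.
  have := sqrD (- (dotmx B B + 1) / dotmx A B).
  by rewrite -A0 mul0r add0r divfK //; have := dotmx_ge0 B; lra.
have := sqrD (- dotmx A B / dotmx A A).
have -> : dotmx A A * (- dotmx A B / dotmx A A) ^+ 2
    + - dotmx A B / dotmx A A * dotmx A B *+ 2 + dotmx B B
    = (dotmx A A * dotmx B B - dotmx A B ^+ 2) / dotmx A A.
  by field; rewrite gt_eqF.
by rewrite pmulr_lge0 ?invr_gt0 // subr_ge0.
Qed.

Lemma dotmx_le (p q : nat) (A B : 'M[R]_(p, q)) (a b : R) : 0 <= a -> 0 <= b ->
  dotmx A A <= a ^+ 2 -> dotmx B B <= b ^+ 2 -> dotmx A B <= a * b.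
Proof.
move=> a0 b0 Aa Bb; rewrite (le_trans (ler_norm _)) //.
rewrite -(ler_pXn2r (_ : 0 < 2)%N) ?nnegrE ?mulr_ge0 // real_normK ?num_real //.
rewrite (le_trans (Cauchy_Schwarz_dotmx _ _)) // exprMn.
by rewrite ler_pM ?dotmx_ge0.
Qed.

Lemma Bessel_dotmx (p q l : nat) (U : 'M[R]_(p, q)) (A : 'M[R]_(p, l)) :
  U^T *m U = 1%:M -> dotmx (U^T *m A) (U^T *m A) <= dotmx A A.
Proof.
move=> UU; have := dotmx_ge0 (A - U *m (U^T *m A)).
have UUA : dotmx A (U *m (U^T *m A)) = dotmx (U^T *m A) (U^T *m A).
  by rewrite dotmx_mull.
rewrite -!scaleN1r dotmxDr dotmxZr ![dotmx (_ + _) _]dotmxC !dotmxDr !dotmxZr.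
rewrite (dotmxC _ A) UUA [dotmx (U *m _) (U *m _)]dotmx_mull.
by rewrite [U^T *m (U *m _)]mulmxA UU mul1mx; lra.
Qed.

Lemma dotmx_diag_le (p q : nat) (d : 'rV[R]_p) (A : 'M[R]_(p, q)) c :
  (forall i, 0 <= d 0 i <= c) ->
  dotmx (diag_mx d *m A) (diag_mx d *m A) <= c ^+ 2 * dotmx A A.
Proof.
move=> dc; rewrite !dotmxE mulr_sumr; apply: ler_sum => j _.
rewrite mulr_sumr; apply: ler_sum => i _; rewrite mul_diag_mx mxE.
have /andP[d0 d1] := dc i; rewrite mulrACA -!expr2.
by rewrite ler_wpM2r ?sqr_ge0 // ler_pXn2r ?nnegrE // (le_trans d0).
Qed.

Lemma dotmx_svd_le (p q l : nat) (U : 'M[R]_(p, q)) (d : 'rV[R]_q)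
    (X : 'M[R]_(p, l)) (D : 'M[R]_(q, l)) (c x y : R) :
  U^T *m U = 1%:M -> 0 <= c -> (forall i, 0 <= d 0 i <= c) ->
  0 <= x -> dotmx X X <= x ^+ 2 -> 0 <= y -> dotmx D D <= y ^+ 2 ->
  dotmx X (U *m diag_mx d *m D) <= x * (c * y).
Proof.
move=> UU c0 dc x0 Xx y0 Dy; rewrite -mulmxA dotmx_mull.
apply: dotmx_le => //; first exact: mulr_ge0.
  exact: le_trans (Bessel_dotmx _ UU) Xx.
by rewrite exprMn (le_trans (dotmx_diag_le _ dc)) // ler_wpM2l ?sqr_ge0.
Qed.

Lemma dotmx_svd (m n p : nat) (A : 'M[R]_(m, n)) (U : 'M[R]_(m, p))
    (sigma : 'rV[R]_p) (V : 'M[R]_(n, p)) :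
  is_svd A U sigma V -> dotmx A A = \sum_i sigma 0 i ^+ 2.
Proof.
move=> [UU VV _ _ AE]; rewrite {2}AE -mulmxA dotmx_mull {1}AE -!mulmxA mulmxA UU mul1mx.
rewrite /dotmx trmx_mul trmxK mulmxA mxtrace_mulC 2!mulmxA VV mul1mx tr_diag_mx.
rewrite mulmx_diag mxtrace_diag; apply: eq_bigr => i _.
by rewrite mxE expr2.
Qed.

Lemma dotmx_assign (p k : nat) (a : 'I_p -> 'I_k) :
  dotmx (assign_mx a) (assign_mx a) = p%:R :> R.
Proof.
rewrite /dotmx trace_assign_mx (eq_bigr (fun=> 1)) => [|i _].
  by rewrite sumr_const card_ord.
by rewrite mxE eqxx.
Qed.

End Frobenius.

Section Agreements.
Context {R : realType} {m n k : nat}.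
Notation vertex := ('I_m + 'I_n)%type.
Variable B : 'M[R]_(m, n).
Hypothesis B_sign : forall i j, B i j = 1 \/ B i j = -1.

Definition separates_as (P : {set {set vertex}})
    (a : 'I_m -> 'I_k) (b : 'I_n -> 'I_k) :=
  forall i j, same_cluster P (inl i) (inr j) = (a i == b j).

Lemma separates_as_clustering_of a b :
  separates_as (clustering_of (assign_mx a : 'M[R]__) (assign_mx b)) a b.
Proof. by move=> i j; rewrite same_cluster_assign. Qed.

Lemma agreeE P a b : separates_as P a b ->
  (agree B P)%:R = \sum_i \sum_j (1 - B i j) / 2
                   + dotmx (assign_mx a) (B *m assign_mx b) :> R.
Proof.
move=> Pab; rewrite /dotmx mulmxA trace_bilinear -big_split /=.
rewrite /agree -2!sum1dep_card natrD !natr_sum big_mkcond [X in _ + X]big_mkcond.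
rewrite -big_split /=; under [RHS]eq_bigr do rewrite -big_split /=.
rewrite [RHS]pair_bigA /=; apply: eq_bigr => -[i j] _ /=; rewrite Pab.
have N11 : (-1 == 1 :> R) = false by apply/eqP; lra.
by case: (B_sign i j) => ->; rewrite ?eqxx ?N11 ?(eq_sym 1) ?N11;
  case: (a i == b j) => /=; lra.
Qed.

Lemma clustering_separates P : clustering_at_most k P -> (0 < k)%N ->
  exists a b, separates_as P a b.
Proof.
move=> [/and3P[/eqP coverP trivP _] cardP] k0.
pose label x := insubd (Ordinal k0) (index (pblock P x) (enum P)).
exists (fun i => label (inl i)), (fun j => label (inr j)) => i j.
have inP x : pblock P x \in enum P by rewrite mem_enum pblock_mem // coverP inE.
have ltk x : (index (pblock P x) (enum P) < k)%N.
  by rewrite (leq_trans _ cardP) // cardE index_mem.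
apply/'exists_andP/eqP => [[A [PA /andP[Ai Aj]]]|].
  by rewrite /label !(def_pblock trivP PA).
move/(congr1 val); rewrite !insubdK ?(ltk, unfold_in) // => /index_inj-/(_ (pblock P (inl i)) (inP _) (inP _)) ij.
exists (pblock P (inl i)); rewrite -mem_enum inP mem_pblock coverP inE /=.
by rewrite ij mem_pblock coverP inE.
Qed.

(** The single cluster attains the number of positive edges, the clustering
    [{U, V}] the number of negative ones. *)
Lemma optimal_agree_ge P : (1 < k)%N -> optimal_clustering k B P ->
  (m * n)%:R / 2 <= (agree B P)%:R :> R.
Proof.
move=> k1 [_ Popt].
pose c0 : 'I_k := Ordinal (ltnW k1); pose c1 : 'I_k := Ordinal k1.
have agree_const c c' := agreeE (separates_as_clustering_of (fun=> c) (fun=> c')).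
have := Popt _ (clustering_of_assign (R := R) (fun=> c0) (fun=> c0)).
have := Popt _ (clustering_of_assign (R := R) (fun=> c0) (fun=> c1)).
rewrite -!(ler_nat R) !agree_const /dotmx !mulmxA !trace_bilinear.
have -> : \sum_i \sum_j B i j * (c0 == c1)%:R = 0.
  by rewrite big1 // => i _; rewrite big1 // => j _; rewrite mulr0.
have -> : \sum_i \sum_j B i j * (c0 == c0)%:R
          = (m * n)%:R - 2 * \sum_i \sum_j (1 - B i j) / 2.
  rewrite mulr_sumr; apply: (canRL (addrK _)); rewrite -big_split /=.
  rewrite (eq_bigr (fun=> n%:R)) => [|i _].
    by rewrite sumr_const card_ord mulnC natrM mulr_natr.
  rewrite mulr_sumr -big_split /= (eq_bigr (fun=> 1)) => [|j _].
    by rewrite sumr_const card_ord.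
  by rewrite ?eqxx; field.
by lra.
Qed.

Lemma dotmx_sign : dotmx B B = (m * n)%:R.
Proof.
rewrite dotmxE (eq_bigr (fun=> m%:R)) => [|j _].
  by rewrite sumr_const card_ord natrM mulr_natr.
rewrite (eq_bigr (fun=> 1)) => [|i _]; first by rewrite sumr_const card_ord.
by case: (B_sign i j) => ->; lra.
Qed.

End Agreements.

Section Solver.
Context {R : realType} {m n k : nat}.
Variable F : factors R m n.
Notation s := (fdim F).
Notation US := (fleft F *m diag_mx (fvals F)).

Lemma recorded_valueE (X : 'M[R]_(m, k)) Y :
  dotmx (fright F *m (US^T *m X)) Y = dotmx X (mx_of_factors F *m Y) :> R.
Proof. by rewrite /dotmx !trmx_mul !trmxK !mulmxA. Qed.

Lemma solverE (eps : R) X Y t :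
  bilinear_low_rank_solver F eps (@row_argmax R k m) (@row_argmax R k n) (X, Y) t ->
  exists (N : seq 'cV[R]_s) (a : 'I_m -> 'I_k) (b : 'I_n -> 'I_k),
  [/\ eps_net eps N, X = assign_mx a, Y = assign_mx b,
      forall C : 'M[R]_(s, k), (forall j, col j C \in N) ->
        exists2 a' : 'I_m -> 'I_k,
          forall i j, (US *m C) i j <= (US *m C) i (a' i)
        & forall b' : 'I_n -> 'I_k,
            dotmx (assign_mx a') (mx_of_factors F *m assign_mx b')
            <= dotmx X (mx_of_factors F *m Y)
    & (t <= s * size N + 2 * (m * s * s)
            + size N ^ k * (s * k + 4 * (s * k * (m + n)) + 4 * (k * (m + n)) + 1))%N].
Proof.
move=> [N [t1 [t2 [[netN ->] sol ->]]]].
have {sol} [_ [t3 [t4 [/matmulPE[-> ->] sol ->]]]] := sol.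
have {sol} [rec [t5 [t6 [[c [recP ->]] sol ->]]]] := sol.
have {sol} [best [t7 [t8 [/argmaxPE[_ bestP t7P] [XYE ->] ->]]]] := sol.
have {}recP (f : {ffun 'I_k -> 'I_(size N)}) : exists (a : 'I_m -> 'I_k) (b : 'I_n -> 'I_k),
    let C := \matrix_(i, j) (nth 0 N (f j)) i 0 in
    [/\ forall i j, (US *m C) i j <= (US *m C) i (a i),
        forall b' : 'I_n -> 'I_k, dotmx (assign_mx a) (mx_of_factors F *m assign_mx b')
               <= dotmx (assign_mx a) (mx_of_factors F *m assign_mx b),
        rec f = (dotmx (assign_mx a) (mx_of_factors F *m assign_mx b),
                 (assign_mx a, assign_mx b))
      & (c f <= s * k + 4 * (s * k * (m + n)) + 4 * (k * (m + n)))%N].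
  move: (recP f) => [_ [c1 [d1 [/mxloop_charge[-> ->] r ->]]]].
  have {r} [_ [c2 [d2 [/matmulPE[-> ->] r ->]]]] := r.
  have {r} [_ [c3 [d3 [/row_argmaxE[a [-> La c3P]] r ->]]]] := r.
  have {r} [_ [c4 [d4 [/matmulPE[-> ->] r ->]]]] := r.
  have {r} [_ [c5 [d5 [/matmulPE[-> ->] r ->]]]] := r.
  have {r} [_ [c6 [d6 [/row_argmaxE[b [-> Rb c6P]] r ->]]]] := r.
  have {r} [_ [c7 [d7 [/trdotPE[-> ->] [-> ->] ->]]]] := r.
  exists a, b; split=> //.
  - by move=> b'; have := trace_argmax b' Rb; rewrite -2!recorded_valueE
      -![\tr _]/(dotmx _ _) ![dotmx (assign_mx _) _]dotmxC.
  - by rewrite -recorded_valueE.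
  - move: c3P c6P; nia.
move: (recP best) => [a [b [_ _ recE _]]].
move: XYE bestP; rewrite recE /= => -[-> ->] bestP; exists N, a, b; split=> //.
  move=> C CN; have ltN j : (index (col j C) N < size N)%N by rewrite index_mem.
  pose f : {ffun 'I_k -> 'I_(size N)} := [ffun j => Ordinal (ltN j)].
  have CE : \matrix_(i, j) N`_(f j) i 0 = C.
    by apply/matrixP => i j; rewrite mxE ffunE /= nth_index // mxE.
  move: (recP f) (bestP f) => [a' [b' /= []]]; rewrite CE => La' Rb' -> _.
  rewrite mem_enum => /(_ isT) /= le_best.
  by exists a' => // b''; exact: le_trans le_best.
move: t7P; rewrite -cardE card_ffun !card_ord => t7P.
have : (\sum_f c f <= size N ^ k * (s * k + 4 * (s * k * (m + n)) + 4 * (k * (m + n))))%N.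
  rewrite -[(_ ^ _)%N](_ : #|{ffun 'I_k -> 'I_(size N)}| = _)%N; last first.
    by rewrite card_ffun !card_ord.
  by rewrite -sum_nat_const; apply: leq_sum => f _; case: (recP f) => ? [? []].
move: (\sum_f c f)%N t7P => S; move: (size N ^ k)%N => Z.
move: (_ + 4 * (k * (m + n)))%N => W t7P SW.
by rewrite mulnDr muln1; lia.
Qed.

Lemma norm2_sqr (p : nat) (x : 'cV[R]_p) : norm2 x ^+ 2 = dotmx x x.
Proof.
rewrite sqr_sqrtr; last by apply: sumr_ge0 => i _; exact: sqr_ge0.
rewrite dotmxE big_ord1; apply: eq_bigr => i _; exact: expr2.
Qed.

Lemma dotmx_col (p q : nat) (A B : 'M[R]_(p, q)) :
  dotmx A B = \sum_j dotmx (col j A) (col j B).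
Proof.
rewrite dotmxE; apply: eq_bigr => j _; rewrite dotmxE big_ord1.
by apply: eq_bigr => i _; rewrite !mxE.
Qed.

Lemma dotmx_col_assign_le (p : nat) (b : 'I_p -> 'I_k) j :
  dotmx (col j (assign_mx b)) (col j (assign_mx b)) <= p%:R :> R.
Proof.
rewrite -(dotmx_assign b) [leRHS]dotmx_col (bigD1 j) //= lerDl.
by apply: sumr_ge0 => *; apply: dotmx_ge0.
Qed.

(** The net is a net of the unit ball, so it is used on the columns of
    [V^T Y] divided by [sqrt n]. *)
Lemma net_approx (N : seq 'cV[R]_s) (eps : R) (b : 'I_n -> 'I_k) : (0 < n)%N ->
  0 <= eps -> eps_net eps N -> (fright F)^T *m fright F = 1%:M ->
  exists C : 'M[R]_(s, k), (forall j, col j C \in N) /\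
    exists D : 'M[R]_(s, k),
      (fright F)^T *m assign_mx b = Num.sqrt n%:R *: (C + D)
      /\ dotmx D D <= (Num.sqrt k%:R * eps) ^+ 2.
Proof.
move=> n0 eps0 [netN _] VV; set y := Num.sqrt n%:R.
have y0 : 0 < y by rewrite sqrtr_gt0 ltr0n.
have y2 : y ^+ 2 = n%:R by rewrite sqr_sqrtr // ler0n.
pose E := y^-1 *: ((fright F)^T *m assign_mx b).
have normE j : norm2 (col j E) <= 1.
  rewrite -(ler_pXn2r (_ : 0 < 2)%N) ?nnegrE ?sqrtr_ge0 // norm2_sqr expr1n.
  rewrite /E linearZ /= dotmxZr dotmxC dotmxZr mulrA -expr2 exprVn y2.
  rewrite mulrC ler_pdivrMr ?ltr0n // mul1r colE -mulmxA -colE.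
  exact: le_trans (Bessel_dotmx _ VV) (dotmx_col_assign_le b j).
have netE j : exists c, c \in N /\ norm2 (col j E - c) <= eps.
  by have [c cN cE] := netN _ (normE j); exists c.
have [c cP] := fin_all_exists netE; pose C := \matrix_(i, j) c j i 0.
have colC j : col j C = c j by apply/colP => i; rewrite !mxE.
exists C; split=> [j|]; first by rewrite colC; case: (cP j).
exists (E - C); split; first by rewrite addrC subrK scalerA divff ?gt_eqF // scale1r.
rewrite dotmx_col exprMn sqr_sqrtr // -[k in leRHS]card_ord mulr_natl -sumr_const.
apply: ler_sum => j _; rewrite linearB /= colC -norm2_sqr.
by rewrite ler_pXn2r ?nnegrE ?sqrtr_ge0 //; case: (cP j).
Qed.

Lemma solver_guarantee (eps c : R) X Y t : (0 < n)%N -> 0 <= eps ->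
  (fleft F)^T *m fleft F = 1%:M -> (fright F)^T *m fright F = 1%:M ->
  0 <= c -> (forall i, 0 <= fvals F 0 i <= c) ->
  bilinear_low_rank_solver F eps (@row_argmax R k m) (@row_argmax R k n) (X, Y) t ->
  forall (a : 'I_m -> 'I_k) (b : 'I_n -> 'I_k),
    dotmx (assign_mx a) (mx_of_factors F *m assign_mx b)
    <= dotmx X (mx_of_factors F *m Y)
       + 2 * eps * Num.sqrt k%:R * c * (Num.sqrt m%:R * Num.sqrt n%:R).
Proof.
move=> n0 eps0 UU VV c0 Fc /solverE[N [a0 [b0 [netN _ _ best _]]]] a b.
have [C [CN [D [VY Dle]]]] := net_approx b n0 eps0 netN VV.
have [a' La' le_best] := best C CN.
set y := Num.sqrt n%:R in VY *; set e := Num.sqrt m%:R * (c * (Num.sqrt k%:R * eps)).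
have valE (a1 : 'I_m -> 'I_k) : dotmx (assign_mx a1) (mx_of_factors F *m assign_mx b)
    = y * (dotmx (assign_mx a1) (US *m C) + dotmx (assign_mx a1) (US *m D)).
  by rewrite /mx_of_factors -mulmxA VY -dotmxDr -dotmxZr -mulmxDr scalemxAr.
have err D' : dotmx D' D' <= (Num.sqrt k%:R * eps) ^+ 2 ->
    forall a1 : 'I_m -> 'I_k, dotmx (assign_mx a1) (US *m D') <= e.
  move=> D'le a1; apply: dotmx_svd_le => //; rewrite ?sqrtr_ge0 ?mulr_ge0 ?sqrtr_ge0 //.
  by rewrite dotmx_assign sqr_sqrtr ?ler0n.
have err1 := err D Dle a.
have err2 : - e <= dotmx (assign_mx a') (US *m D).
  rewrite lerNl -mulN1r -dotmxZr scalemxAr; apply: err.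
  by rewrite dotmxZr dotmxC dotmxZr !mulN1r opprK.
have := trace_argmax a La'; rewrite -!/(dotmx _ _) => arg.
rewrite (le_trans _ (lerD (le_best b) (lexx _))) // !valE.
have -> : 2 * eps * Num.sqrt k%:R * c * (Num.sqrt m%:R * y) = y * (2 * e).
  by rewrite /e; ring.
by rewrite -mulrDr ler_wpM2l ?sqrtr_ge0 //; lra.
Qed.

End Solver.

Section TruncatedSVD.
Context {R : realType} {m n : nat}.
Variables (B : 'M[R]_(m, n)) (r : nat) (F : factors R m n).
Hypothesis svdF : truncated_svd B r F.

Lemma truncated_svd_orthonormal :
  (fleft F)^T *m fleft F = 1%:M /\ (fright F)^T *m fright F = 1%:M.
Proof.
have [q [U' [s' [V' [[UU VV _ _ _] _]]]]] := svdF.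
move: UU VV; rewrite !tr_row_mx !mul_col_row !scalar_mx_block.
by move=> /eq_block_mx[-> _ _ _] /eq_block_mx[-> _ _ _].
Qed.

Lemma truncated_svd_rank : (fdim F <= r)%N.
Proof. by have [q [_ [_ [_ [_ ->]]]]] := svdF; exact: geq_minl. Qed.

Lemma truncated_svd_vals_le i c : 0 <= c -> dotmx B B <= c ^+ 2 ->
  0 <= fvals F 0 i <= c.
Proof.
move=> c0 Bc; have [q [U' [s' [V' [svdB _]]]]] := svdF.
have sum_s := dotmx_svd svdB; have [_ _ s0 _ _] := svdB.
have := s0 (lshift _ i); rewrite row_mxEl => si0; rewrite si0 /=.
rewrite -(ler_pXn2r (_ : 0 < 2)%N) ?nnegrE // (le_trans _ Bc) // sum_s.
rewrite (bigD1 (lshift _ i)) //= row_mxEl lerDl.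
by apply: sumr_ge0 => j _; exact: sqr_ge0.
Qed.

Lemma truncated_svd_error (l : nat) (X : 'M[R]_(m, l)) (Y : 'M[R]_(n, l)) (x y d : R) :
  0 <= d -> dotmx B B <= r.+1%:R * d ^+ 2 ->
  0 <= x -> dotmx X X <= x ^+ 2 -> 0 <= y -> dotmx Y Y <= y ^+ 2 ->
  dotmx X (B *m Y) <= dotmx X (mx_of_factors F *m Y) + x * (d * y).
Proof.
move=> d0 Bd x0 Xx y0 Yy; have [q [U' [s' [V' [svdB rE]]]]] := svdF.
have sum_s := dotmx_svd svdB; have [UU VV s0 s_le BE] := svdB.
have U'U' : U'^T *m U' = 1%:M.
  by move: UU; rewrite tr_row_mx mul_col_row scalar_mx_block => /eq_block_mx[].
have V'V' : V'^T *m V' = 1%:M.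
  by move: VV; rewrite tr_row_mx mul_col_row scalar_mx_block => /eq_block_mx[].
have -> : B = mx_of_factors F + U' *m diag_mx s' *m V'^T.
  rewrite BE diag_mx_row mul_row_block !mulmx0 addr0 add0r.
  by rewrite tr_row_mx mul_row_col.
rewrite mulmxDl dotmxDr lerD2l -[_ *m V'^T *m _]mulmxA.
apply: dotmx_svd_le => //; last exact: le_trans (Bessel_dotmx _ V'V') Yy.
move=> i; have := s0 (rshift _ i); rewrite row_mxEr => si0; rewrite si0 /=.
have rF : fdim F = r.
  by move: rE (ltn_ord i); rewrite /minn; case: ltnP => // _; lia.
rewrite -(ler_pXn2r (_ : 0 < 2)%N) ?nnegrE // -(ler_pM2l (ltr0Sn _ r)).
rewrite (le_trans _ Bd) // sum_s big_split_ord /= -natr1 mulrDl mul1r.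
apply: lerD.
  rewrite -[r in leLHS]rF -[fdim F in leLHS]card_ord mulr_natl -sumr_const.
  apply: ler_sum => j _.
  have := s_le (lshift _ j) (rshift _ i); rewrite row_mxEl row_mxEr => sij.
  rewrite ler_pXn2r ?nnegrE //; first by apply: sij; rewrite /= ltnW // ltn_addr.
  by have := s0 (lshift _ j); rewrite row_mxEl.
rewrite (bigD1 i) //= row_mxEr lerDl.
by apply: sumr_ge0 => j _; exact: sqr_ge0.
Qed.

End TruncatedSVD.

Section RunningTime.
Context {R : realType}.

Lemma ln_ge1BV (x : R) : 0 < x -> 1 - x^-1 <= ln x.
Proof.
move=> x0; have xV0 : 0 < x^-1 by rewrite invr_gt0.
have := le_ln1Dx (_ : -1 < x^-1 - 1).
by rewrite addrCA subrr addr0 lnV ?posrE // => /(_ _); lra.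
Qed.

(** [x] stands for [k / delta^2].  The linear term of [64 x (7 + ln x)] is absorbed
    by [x <= x ln x + 1], which remains usable as [x] tends to [1]. *)
Lemma net_power_le (k s z : nat) (x : R) : 1 <= x -> (s * k)%:R <= 64 * x ->
  z%:R <= (128 * x) ^+ s -> (z ^ k)%:R <= expR 448 * expR (512 * (x * ln x)).
Proof.
move=> x1 skx zx; have x0 : 0 < x by lra.
have lnx0 : 0 <= ln x by rewrite ln_ge0.
have xlnx : x <= x * ln x + 1.
  have := ler_wpM2l (ltW x0) (ln_ge1BV x0).
  by rewrite mulrBr mulr1 divff ?gt_eqF //; lra.
rewrite natrX (le_trans (lerXn2r _ _ _ zx)) ?nnegrE ?exprn_ge0 //; try lra.
rewrite -exprM -[128 * x]lnK ?posrE; last lra.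
rewrite -expRM_natl -expRD ler_expR.
have -> : 128 * x = 2 ^+ 7 * x by ring.
rewrite lnM ?posrE ?exprn_gt0 // lnXn //.
have ln2 : ln 2 <= 1 :> R by have := le_ln1Dx (_ : -1 < 1 :> R); apply; lra.
have le7 : ln 2 *+ 7 + ln x <= 7 + ln x by lra.
rewrite (le_trans (ler_wpM2l _ le7)) ?ler0n //.
rewrite (le_trans (ler_wpM2r _ skx)) //; first lra.
have -> : 64 * x * (7 + ln x) = 448 * x + 64 * (x * ln x) by ring.
by have := ler_wpM2l (_ : 0 <= 448) xlnx; lra.
Qed.

Lemma step_count_le (k s z Z w : nat) : (0 < k)%N -> (0 < w)%N -> (0 < Z)%N ->
  (z <= Z)%N ->
  (s * z + 2 * (w * s * s) + Z * (s * k + 4 * (s * k * w) + 4 * (k * w) + 1)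
    <= Z * w * (s * k + 2 * (s * k) ^ 2 + 5 * (s * k) + 4 * k + 1))%N.
Proof.
move=> k0 w0 Z0 zZ; have sk_s : (s <= s * k)%N by rewrite leq_pmulr.
have le1 : (s * z <= s * k * (Z * w))%N.
  by rewrite leq_mul // (leq_trans zZ) // leq_pmulr.
have le2 : (w * s * s <= (s * k) ^ 2 * (Z * w))%N.
  by rewrite -mulnA mulnC -mulnn leq_mul ?leq_mul // leq_pmull.
have le3 : (s * k + 4 * (s * k * w) + 4 * (k * w) + 1
            <= w * (5 * (s * k) + 4 * k + 1))%N.
  have : (s * k <= s * k * w)%N by rewrite leq_pmulr.
  by move: (s * k)%N => u; lia.
have := leq_mul (leqnn Z) le3; move: le1 le2.
move: (s * k)%N ((s * k) ^ 2)%N (s * k + 4 * (s * k * w) + _ + _)%N => u v c.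
by lia.
Qed.

Lemma running_time_le (k s z w : nat) (delta K : R) :
  K = 100 ^+ 2 * expR 448 ->
  (0 < k)%N -> (0 < w)%N -> (0 < z)%N -> 0 < delta -> delta < 1 ->
  s%:R <= 64 / delta ^+ 2 ->
  z%:R <= (2 * Num.sqrt s%:R / (2 ^- 3 * delta / Num.sqrt k%:R)) ^+ s ->
  (s * z + 2 * (w * s * s) + z ^ k * (s * k + 4 * (s * k * w) + 4 * (k * w) + 1))%:R
  <= K * 2 `^ (K * (k%:R / delta ^+ 2 * ln (Num.sqrt k%:R / delta)))
       * (delta ^- 2 + k%:R) * w%:R.
Proof.
move=> KE k0 w0 z0 d0 d1 sd zd.
have [x xE] : exists x, x = k%:R / delta ^+ 2 by exists (k%:R / delta ^+ 2).
have k1 : 1 <= k%:R :> R by rewrite ler1n.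
have d2 : 0 < delta ^+ 2 by rewrite exprn_gt0.
have dV1 : 1 <= (delta ^+ 2)^-1 by rewrite invf_ge1 // expr_le1 // ltW.
have dVx : (delta ^+ 2)^-1 <= x by rewrite xE ler_peMl // ltW // invr_gt0.
have kx : k%:R <= x by rewrite xE ler_peMr // ler0n.
have x1 : 1 <= x by exact: le_trans kx.
have x0 : 0 < x by lra.
have skx : (s * k)%:R <= 64 * x.
  rewrite natrM (le_trans (ler_wpM2r (ler0n _ _) sd)) //.
  by rewrite xE mulrAC mulrA.
have base_le : 2 * Num.sqrt s%:R / (2 ^- 3 * delta / Num.sqrt k%:R) <= 128 * x.
  have sqk : 0 < Num.sqrt k%:R :> R by rewrite sqrtr_gt0 ltr0n.
  have -> : 2 * Num.sqrt s%:R / (2 ^- 3 * delta / Num.sqrt k%:R)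
            = 16 * (Num.sqrt s%:R * Num.sqrt k%:R) / delta :> R.
    by field; rewrite !gt_eqF.
  rewrite -(ler_pXn2r (_ : 0 < 2)%N) ?nnegrE //; last 2 first.
  - by rewrite !mulr_ge0 ?sqrtr_ge0 ?invr_ge0 ?ltW.
  - lra.
  rewrite !exprMn !sqr_sqrtr ?ler0n // -natrM exprVn.
  rewrite (_ : 16 ^+ 2 * (s * k)%:R / delta ^+ 2
               = 256 * ((s * k)%:R * (delta ^+ 2)^-1)); last by ring.
  have := ler_pM (ler0n R _) _ skx dVx; rewrite invr_ge0 => /(_ (ltW d2)) le.
  have -> : 128 ^+ 2 * x ^+ 2 = 256 * (64 * x * x) by ring.
  by rewrite ler_pM2l.
have zx : z%:R <= (128 * x) ^+ s.
  rewrite (le_trans zd) // lerXn2r ?nnegrE //; last lra.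
  rewrite divr_ge0 ?mulr_ge0 ?divr_ge0 ?mulr_ge0 ?sqrtr_ge0 ?invr_ge0 ?exprn_ge0 ?ltW //.
  by rewrite sqrtr_gt0 ltr0n.
have Zx := net_power_le x1 skx zx.
have zZ : (z <= z ^ k)%N by rewrite -[leqLHS]expn1 leq_pexp2l.
have Z0 : (0 < z ^ k)%N by rewrite expn_gt0 z0.
set Z := (z ^ k)%N in Zx zZ Z0 *.
have count_le : (s * z + 2 * (w * s * s) + Z * (s * k + 4 * (s * k * w) + 4 * (k * w) + 1)
    <= Z * w * (s * k + 2 * (s * k) ^ 2 + 5 * (s * k) + 4 * k + 1))%N.
  exact: step_count_le.
have poly_le : (s * k + 2 * (s * k) ^ 2 + 5 * (s * k) + 4 * k + 1)%:R <= 100 ^+ 2 * x ^+ 2.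
  rewrite !natrD natrX.
  have sk2 : (s * k)%:R ^+ 2 <= (64 * x) ^+ 2 by rewrite lerXn2r ?nnegrE //; lra.
  have xx : x <= x ^+ 2 by rewrite expr2 ler_peMl // ltW.
  by lra.
have lnx0 : 0 <= ln x by rewrite ln_ge0.
have x2_le : x ^+ 2 <= expR (2 * (x * ln x)).
  rewrite -[x in leLHS]lnK ?posrE // -expRM_natl ler_expR ler_wpM2l //.
  by rewrite ler_peMl.
have lnE : ln (Num.sqrt k%:R / delta) = ln x / 2.
  have -> : x = (Num.sqrt k%:R / delta) ^+ 2.
    by rewrite xE exprMn sqr_sqrtr ?ler0n // exprVn.
  by rewrite lnXn ?divr_gt0 ?sqrtr_gt0 ?ltr0n //; lra.
have K_ge : 4 * 514 <= K.
  have := expR_ge1Dx (448 : R); rewrite KE; lra.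
have K0 : 0 <= K by lra.
have pow_ge : expR (514 * (x * ln x)) <= 2 `^ (K * (x * ln (Num.sqrt k%:R / delta))).
  rewrite /powR pnatr_eq0 /= ler_expR lnE.
  have ln2 : 1 / 2 <= ln 2 :> R by have := @ln_ge1BV 2 (ltr0n _ _); lra.
  have xl0 : 0 <= x * ln x by rewrite mulr_ge0 // ltW.
  have : K / 4 * (x * ln x) <= K * (x * (ln x / 2)) * ln 2.
    have -> : K / 4 * (x * ln x) = K * (x * (ln x / 2)) * (1 / 2) by field.
    by rewrite ler_wpM2l // mulr_ge0 // mulr_ge0 ?(ltW x0) ?divr_ge0.
  by apply: le_trans; rewrite ler_wpM2r //; lra.
rewrite -(ler_nat R) in count_le; rewrite -xE (le_trans count_le) //.
rewrite natrM [X in X * _]natrM -mulrA [w%:R * _]mulrC mulrA ler_wpM2r ?ler0n //.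
rewrite (le_trans (ler_pM _ _ Zx poly_le)) ?ler0n //.
have le_pow : expR 448 * expR (512 * (x * ln x)) * (100 ^+ 2 * x ^+ 2)
    <= K * expR (514 * (x * ln x)).
  have -> : expR (514 * (x * ln x)) = expR (512 * (x * ln x)) * expR (2 * (x * ln x)).
    by rewrite -expRD; congr expR; ring.
  rewrite KE.
  have := ler_wpM2l (mulr_ge0 (expR_ge0 448) (expR_ge0 (512 * (x * ln x)))) x2_le.
  by lra.
rewrite (le_trans le_pow) // (le_trans (ler_wpM2l K0 pow_ge)) //.
rewrite ler_peMr //; last by lra.
by rewrite mulr_ge0 ?powR_ge0 //; lra.
Qed.

End RunningTime.

Lemma svd_rank_bounds (R : realType) (delta : R) : 0 < delta -> delta < 1 ->
  64 / delta ^+ 2 <= (svd_rank delta).+1%:R /\ (svd_rank delta)%:R <= 64 / delta ^+ 2.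
Proof.
move=> d0 d1; rewrite /svd_rank; have -> : 2 ^+ 6 = 64 :> R by ring.
set y := 64 / _ - 1; have y0 : 0 <= y.
  rewrite subr_ge0 ler_pdivlMr ?exprn_gt0 // mul1r.
  have : delta ^+ 2 <= 1 by rewrite expr_le1 // ltW.
  by lra.
have c0 : 0 <= Num.ceil y by rewrite ceil_ge0; lra.
have absE : (`|Num.ceil y|%N)%:R = (Num.ceil y)%:~R :> R.
  by rewrite natr_absz ger0_norm.
have hi := ceil_ge y; have lo := ceilB1_lt y; rewrite rmorphB /= in lo.
by rewrite -natr1 absE; split; rewrite /y in lo hi *; lra.
Qed.

Theorem theorem1 (R : realType) :
  exists2 K : R, 0 < K &
  forall (m n k : nat) (B : 'M[R]_(m, n)) (delta : R) (TSVD : nat -> nat)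
         (X : 'M[R]_(m, k)) (Y : 'M[R]_(n, k)) (t : nat),
    (0 < m)%N -> (0 < n)%N -> (1 <= k)%N ->
    (forall i j, B i j = 1 \/ B i j = -1) ->
    0 < delta -> delta < 1 ->
    bcc_procedure B delta TSVD (X, Y) t ->
    [/\ feasible X /\ feasible Y,
        clustering_at_most k (clustering_of X Y),
        forall Cstar, optimal_clustering k B Cstar ->
          (1 - delta) * (agree B Cstar)%:R <= (agree B (clustering_of X Y))%:R
      & t%:R <= K * 2 `^ (K * (k%:R / delta ^+ 2 * ln (Num.sqrt k%:R / delta)))
                  * (delta ^- 2 + k%:R) * (m + n)%:R
                + (TSVD (svd_rank delta))%:R ].
Proof.
exists (100 ^+ 2 * expR 448); first by rewrite mulr_gt0 ?expR_gt0 ?exprn_gt0.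
move=> m n k B delta TSVD X Y t m0 n0 k0 B_sign d0 d1.
move=> [F [_ [t2 [[svdF ->] sol ->]]]].
have [rank_ge rank_le] := svd_rank_bounds d0 d1.
have [UU VV] := truncated_svd_orthonormal svdF.
set eps := 2 ^- 3 * delta / Num.sqrt k%:R in sol.
have sqk : 0 < Num.sqrt k%:R :> R by rewrite sqrtr_gt0 ltr0n.
have eps0 : 0 <= eps by rewrite !mulr_ge0 ?invr_ge0 ?ltW ?exprn_gt0.
pose c : R := Num.sqrt (m * n)%:R.
have c0 : 0 <= c by rewrite sqrtr_ge0.
have c2 : c ^+ 2 = (m * n)%:R by rewrite sqr_sqrtr ?ler0n.
have cE : Num.sqrt m%:R * Num.sqrt n%:R = c by rewrite -sqrtrM ?ler0n // -natrM.
have vals_le i : 0 <= fvals F 0 i <= c.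
  by apply: (truncated_svd_vals_le svdF) => //; rewrite dotmx_sign // c2.
have guarantee := solver_guarantee n0 eps0 UU VV c0 vals_le sol.
have [N [a [b [netN XE YE _ t2_le]]]] := solverE sol; subst X Y.
have sep_ab := separates_as_clustering_of (R := R) a b.
split.
- by split; exact: assign_mx_feasible.
- exact: clustering_of_assign.
- move=> P optP; have [a' [b' Pab]] := clustering_separates optP.1 k0.
  have [k1|k1] := leqP k 1.
    have assignE p (f g : 'I_p -> 'I_k) : assign_mx f = assign_mx g :> 'M[R]__.
      apply/matrixP => i j; rewrite !mxE (_ : f i = g i) //; apply: val_inj => /=.
      by move: (ltn_ord (f i)) (ltn_ord (g i)); lia.
    rewrite (agreeE B_sign Pab) (agreeE B_sign sep_ab).
    rewrite (assignE _ a' a) (assignE _ b' b).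
    rewrite -(agreeE B_sign sep_ab).
    by rewrite ler_piMl ?ler0n //; lra.
  have := optimal_agree_ge B_sign k1 optP.
  rewrite (agreeE B_sign Pab) (agreeE B_sign sep_ab).
  have normX p (f : 'I_p -> 'I_k) :
      dotmx (assign_mx f) (assign_mx f) <= Num.sqrt p%:R ^+ 2 :> R.
    by rewrite dotmx_assign sqr_sqrtr ?ler0n.
  have B_le : dotmx B B <= (svd_rank delta).+1%:R * (c * delta / 8) ^+ 2.
    rewrite dotmx_sign // -c2.
    have -> : c ^+ 2 = 64 / delta ^+ 2 * (c * delta / 8) ^+ 2.
      by field; rewrite gt_eqF.
    by rewrite ler_wpM2r ?sqr_ge0.
  have dc0 : 0 <= c * delta / 8 by rewrite divr_ge0 // mulr_ge0 // ltW.
  have err (X : 'M[R]_(m, k)) : dotmx X X <= Num.sqrt m%:R ^+ 2 ->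
      forall b1 : 'I_n -> 'I_k, dotmx X (B *m assign_mx b1)
        <= dotmx X (mx_of_factors F *m assign_mx b1) + (m * n)%:R * delta / 8.
    move=> Xm b1; have := truncated_svd_error svdF dc0 B_le
      (sqrtr_ge0 m%:R) Xm (sqrtr_ge0 n%:R) (normX _ b1).
    rewrite (_ : Num.sqrt m%:R * (c * delta / 8 * Num.sqrt n%:R)
               = (m * n)%:R * delta / 8) //.
    by rewrite mulrCA cE -c2; field.
  have err1 := err _ (normX _ a') b'.
  have err2 : dotmx (assign_mx a) (mx_of_factors F *m assign_mx b)
      <= dotmx (assign_mx a) (B *m assign_mx b) + (m * n)%:R * delta / 8.
    have := err (-1 *: assign_mx a) _ b.
    rewrite dotmxZr dotmxC dotmxZr !mulN1r opprK => /(_ (normX _ a)).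
    by rewrite ![dotmx (-1 *: _) _]dotmxC !dotmxZr ![dotmx _ (assign_mx a)]dotmxC; lra.
  have := guarantee a' b'.
  rewrite (_ : 2 * eps * _ * _ * _ = (m * n)%:R * delta / 4); last first.
    by rewrite cE -c2 /eps; field; rewrite gt_eqF.
  move=> guarantee_ab opt_ge; have := ler_wpM2l (ltW d0) opt_ge.
  by lra.
- rewrite natrD addrC lerD2r.
  have sizeN : (0 < size N)%N.
    have norm0 : norm2 (0 : 'cV[R]_(fdim F)) <= 1.
      by rewrite /norm2 big1 ?sqrtr0 // => i _; rewrite mxE expr0n.
    by have [x xN _] := netN.1 0 norm0; case: N xN {netN t2_le}.
  apply: le_trans (running_time_le erefl k0 _ sizeN d0 d1 _ netN.2).
  + rewrite ler_nat (leq_trans t2_le) // leq_add2r leq_add2l leq_mul2l /=.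
    by rewrite -!mulnA leq_mul2r leq_addr orbT.
  + by rewrite addn_gt0 m0.
  + apply: le_trans rank_le; rewrite ler_nat; exact: truncated_svd_rank svdF.
Qed.
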